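(* Let $\|\cdot\|$ be a norm on $\mathbb{R}^n$ such that $n^{-O(1)} \le \frac{\|x\|}{\|x\|_2} \le n^{O(1)}$ for every nonzero $x \in \mathbb{R}^n$. Suppose there is a streaming algorithm that maintains a vector $x \in \mathbb{R}^n$ under updates of the form $x_i := x_i + \delta_i$ with $\delta_i \in \mathbb{Z}$, where it is promised that at every moment all entries of $x$ are integers between $0$ and $n^{O(1)}$, and which at the end outputs a vector $y$ such that $\|x - y\| \le K \cdot \min_{k\text{-sparse } x^*} \|x - x^*\|$, where $K>2$ is an approximation factor. Then the space (in bits) used by the algorithm is at least $\Omega\left(d \cdot \frac{\log n}{\log K}\right)$, where $d$ is the doubling dimension of the set of non-negative $k$-sparse vectors in $\mathbb{R}^n$ under the metric induced by $\|\cdot\|$.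
   Context: A vector is $k$-sparse if it has at most $k$ nonzero coordinates. The doubling dimension of a metric space is the smallest $d$ such that every ball of radius $r$ can be covered by $2^d$ balls of radius $r/2$. *)

(* Defs.v *)
(* MathComp + MathComp-Analysis *)
From mathcomp Require Import all_boot all_order all_algebra.
From mathcomp Require Import boolp classical_sets reals exp.

Set Implicit Arguments.
Unset Strict Implicit.
Unset Printing Implicit Defensive.

Import Order.TTheory GRing.Theory Num.Theory.
Local Open Scope classical_set_scope.
Local Open Scope ring_scope.

(* The canonical norm `|x| on 'rV[R]_n is the sup norm, so an arbitrary norm is
   a function satisfying the axioms of the library's Lmodule_isNormed. *)
Definition is_norm (R : realType) (n : nat) (N : 'rV[R]_n -> R) : Prop :=
  [/\ forall x y, N (x + y) <= N x + N y,
      forall (a : R) x, N (a *: x) = `|a| * N x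
    & forall x, N x = 0 -> x = 0].

Definition l2norm (R : realType) (n : nat) (x : 'rV[R]_n) : R :=
  Num.sqrt (\sum_(i < n) x 0 i ^+ 2).

Definition sparse (R : realType) (n k : nat) : set 'rV[R]_n :=
  [set x : 'rV[R]_n | (#|[pred i | x 0%R i != 0%R]| <= k)%N].

Definition nonneg_sparse (R : realType) (n k : nat) : set 'rV[R]_n :=
  [set x | sparse k x /\ forall i, 0 <= x 0 i].

(* The set below is nonempty (it contains N x) and bounded below by 0, and its
   infimum is attained: the k-sparse vectors form a finite union of subspaces. *)
Definition best_sparse_error (R : realType) (n k : nat) (N : 'rV[R]_n -> R)
    (x : 'rV[R]_n) : R :=
  inf [set N (x - z) | z in sparse k].

(* Every (closed) ball of the metric space (S, dist) is covered by 2 ^ d balls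
   of half the radius; all centers are points of S. *)
Definition half_covered (R : realType) (T : Type) (S : set T)
    (dist : T -> T -> R) (d : nat) : Prop :=
  forall (c : T) (r : R), S c -> 0 < r ->
    exists f : 'I_(2 ^ d) -> T, (forall i, S (f i)) /\
      forall x, S x -> dist c x <= r -> exists i, dist (f i) x <= r / 2.

Definition doubling_dimension (R : realType) (T : Type) (S : set T)
    (dist : T -> T -> R) (d : nat) : Prop :=
  half_covered S dist d /\ forall d', half_covered S dist d' -> (d <= d')%N.

(* The update (i, delta) stands for x_i := x_i + delta; initially x = 0. *)
Definition stream (n : nat) := seq ('I_n * int).

Definition stream_vector (n : nat) (us : stream n) : 'rV[int]_n :=
  \row_i \sum_(u <- us | u.1 == i) u.2.

Definition promise (n : nat) (B : nat) (us : stream n) : Prop :=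
  forall (m : nat) (i : 'I_n), 0 <= stream_vector (take m us) 0 i <= B%:Z.

(* Between two updates the algorithm retains nothing but s bits of memory; its
   computations are otherwise unrestricted. *)
Record streaming_algorithm (R : realType) (n s : nat) := StreamingAlgorithm {
  initial : s.-tuple bool;
  update : s.-tuple bool -> 'I_n * int -> s.-tuple bool;
  output : s.-tuple bool -> 'rV[R]_n }.

Definition run (R : realType) (n s : nat) (alg : streaming_algorithm R n s)
    (us : stream n) : 'rV[R]_n :=
  output alg (foldl (update alg) (initial alg) us).

Definition solves_sparse_recovery (R : realType) (n s : nat)
    (alg : streaming_algorithm R n s) (N : 'rV[R]_n -> R) (k : nat) (K : R)
    (B : nat) : Prop :=
  forall us : stream n, promise B us ->
    let x : 'rV[R]_n := map_mx intr (stream_vector us) in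
    N (x - run alg us) <= K * best_sparse_error k N x.

(* Main.v *)
Require Import Defs.
From mathcomp Require Import all_boot all_order all_algebra.
From mathcomp Require Import boolp classical_sets reals exp.
From mathcomp Require Import zify ring lra.

Import Order.TTheory GRing.Theory Num.Theory.
Local Open Scope ring_scope.

(** By minimality of [d], some ball of radius [r] is not covered by [2 ^ (d - 1)]
    balls of radius [r / 2], so it contains [2 ^ (d - 1) + 1] points that are
    pairwise more than [r / 2] apart.  Lowering the large coordinates of all of
    them by the same amount, scaling, and rounding down gives integer points
    [z p] with polynomially bounded entries and mutual distances between [6 e]
    and [34 e], where [e = n ^ (a + 1)] bounds the norm of the rounding error.

    A word [w] of length [L], about [log n / log K], is encoded as the vector
    [sum_(i < L) D ^ i * z (w i)] with [D] about [20 K].  The memory after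
    reading this vector determines [w]: knowing the levels above [j], subtract
    them; what remains differs from the sparse vector
    [(sum_(i <= j) D ^ i) * z (w j)] by at most [34 e * sum_(i < j) D ^ i],
    so the output determines [w j].  Hence [(2 ^ (d - 1) + 1) ^ L <= 2 ^ s]. *)

(** * Norms and their comparison with coordinates *)

Lemma is_norm_sym {R : realType} {n : nat} {N : 'rV[R]_n -> R} (hN : is_norm N)
  (x y : 'rV[R]_n) : N (x - y) = N (y - x).
Proof.
by case: hN => _ NZ _; rewrite -[RHS]mul1r -[1](@normrN1 R) -NZ scaleN1r opprB.
Qed.

Lemma is_norm_ge0 {R : realType} {n : nat} {N : 'rV[R]_n -> R} (hN : is_norm N)
  (x : 'rV[R]_n) : 0 <= N x.
Proof.
case: (hN) => ND NZ _.
have := ND x (- x); rewrite subrr.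
have := NZ 0 x; rewrite scale0r normr0 mul0r => ->.
by have := is_norm_sym hN 0 x; rewrite sub0r subr0 => ->; lra.
Qed.

Lemma is_norm_dist_triangle {R : realType} {n : nat} {N : 'rV[R]_n -> R}
  (hN : is_norm N) (z x y : 'rV[R]_n) : N (x - y) <= N (x - z) + N (z - y).
Proof. by case: hN => ND _ _; rewrite -[x - y](subrKA z). Qed.

Lemma is_norm_mulrn {R : realType} {n : nat} {N : 'rV[R]_n -> R}
  (hN : is_norm N) (x : 'rV[R]_n) (m : nat) : N (x *+ m) = m%:R * N x.
Proof. by case: hN => _ NZ _; rewrite -scaler_nat NZ normr_nat. Qed.

Lemma is_norm_sum {R : realType} {n : nat} {N : 'rV[R]_n -> R} (hN : is_norm N)
  {I : Type} (r : seq I) (F : I -> 'rV[R]_n) :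
  N (\sum_(i <- r) F i) <= \sum_(i <- r) N (F i).
Proof.
case: hN => ND NZ _; elim: r => [|i r IH]; last first.
  by rewrite !big_cons (le_trans (ND _ _)) // lerD2l.
by rewrite !big_nil -(scale0r 0) NZ normr0 mul0r.
Qed.

Lemma entry_le_l2norm {R : realType} {n : nat} (x : 'rV[R]_n) (i : 'I_n) :
  `|x 0 i| <= l2norm x.
Proof.
rewrite -sqrtr_sqr ler_wsqrtr // (bigD1 i) //= lerDl.
by apply: sumr_ge0 => j _; rewrite sqr_ge0.
Qed.

Lemma l2norm_le_dim {R : realType} {n : nat} (x : 'rV[R]_n) :
  (forall i, `|x 0 i| <= 1) -> l2norm x <= n%:R.
Proof.
move=> hx; rewrite -[n%:R](@ger0_norm R) // -sqrtr_sqr ler_wsqrtr //.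
apply: (@le_trans _ _ (\sum_(i < n) 1)).
  by apply: ler_sum => i _; rewrite -real_normK ?num_real // exprn_ile1.
rewrite sumr_const card_ord -natrX ler_nat.
by case: n {x hx} => // n; rewrite leq_pmulr.
Qed.

Lemma l2norm_gt0 {R : realType} {n : nat} (x : 'rV[R]_n) :
  x != 0 -> 0 < l2norm x.
Proof.
move=> /rV0Pn[i xi]; apply: lt_le_trans (entry_le_l2norm x i).
by rewrite normr_gt0.
Qed.

Lemma entry_le_norm {R : realType} {n : nat} {N : 'rV[R]_n -> R} {C : R}
  (hN : is_norm N) (hC : 0 < C)
  (hlo : forall x, x != 0 -> C^-1 <= N x / l2norm x)
  (x : 'rV[R]_n) (i : 'I_n) : `|x 0 i| <= C * N x.
Proof.
have [->|x0] := eqVneq x 0.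
  by rewrite mxE normr0; apply: mulr_ge0; [exact: ltW | exact: is_norm_ge0].
apply: le_trans (entry_le_l2norm x i) _.
by have := hlo x x0; rewrite ler_pdivlMr ?l2norm_gt0 // ler_pdivrMl.
Qed.

Lemma norm_le_dim {R : realType} {n : nat} {N : 'rV[R]_n -> R} {C : R}
  (hN : is_norm N) (hC : 0 < C)
  (hup : forall x, x != 0 -> N x / l2norm x <= C)
  (x : 'rV[R]_n) : (forall i, `|x 0 i| <= 1) -> N x <= C * n%:R.
Proof.
move=> hx; have [->|x0] := eqVneq x 0.
  case: hN => _ NZ _; rewrite -(scale0r 0) NZ normr0 mul0r.
  by rewrite mulr_ge0 // ltW.
have := hup x x0; rewrite ler_pdivrMr ?l2norm_gt0 // => /le_trans; apply.
by rewrite ler_pM2l // l2norm_le_dim.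
Qed.

(** * Streams that write and erase integer vectors *)

Definition load {n : nat} (v : 'rV[int]_n) : stream n :=
  [seq (i, v 0 i) | i <- enum 'I_n].

Lemma stream_vector_cat {n : nat} (us vs : stream n) :
  stream_vector (us ++ vs) = stream_vector us + stream_vector vs.
Proof. by apply/rowP => i; rewrite !mxE big_cat. Qed.

Lemma stream_vector_take_load {n : nat} (v : 'rV[int]_n) (m : nat) (i : 'I_n) :
  stream_vector (take m (load v)) 0 i =
    if i \in take m (enum 'I_n) then v 0 i else 0.
Proof.
rewrite mxE -map_take big_map /= -big_filter.
have us : uniq (take m (enum 'I_n)) by rewrite take_uniq ?enum_uniq.
case: ifPn => hi; first by rewrite (filter_pred1_uniq us hi) big_seq1.
rewrite (_ : [seq _ <- _ | _] = [::]) ?big_nil //.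
apply/eqP; rewrite -size_eq0 size_filter -leqn0 leqNgt -has_count.
by apply/hasPn => j hj; apply: contraNneq hi => <-.
Qed.

Lemma stream_vector_load {n : nat} (v : 'rV[int]_n) : stream_vector (load v) = v.
Proof.
apply/rowP => i; have := stream_vector_take_load v (size (enum 'I_n)) i.
by rewrite {1}/load -(size_map (fun j => (j, v 0 j))) !take_size size_map
  take_size mem_enum.
Qed.

(** This is how known levels are erased. Each entry only takes the values 0, its entry in [x + y]
    and its entry in [x], all within the promised range. *)
Lemma promise_load_sub {n B : nat} (x y : 'rV[int]_n) :
  (forall i, 0 <= x 0 i) -> (forall i, 0 <= y 0 i) ->
  (forall i, x 0 i + y 0 i <= B%:Z) ->
  promise B (load (x + y) ++ load (- y)).
Proof.
move=> x0 y0 hB m i; rewrite take_cat; case: ltnP => _.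
  rewrite stream_vector_take_load; case: ifP => _ //.
  by rewrite mxE addr_ge0 ?x0 ?y0 ?hB.
rewrite stream_vector_cat mxE stream_vector_load stream_vector_take_load !mxE.
have := x0 i; have := y0 i; have := hB i; move: (x 0 i) (y 0 i) => u v.
by case: ifP => _; lia.
Qed.

Lemma best_sparse_error_le {R : realType} {n k : nat} {N : 'rV[R]_n -> R}
  (hN : is_norm N) (x z : 'rV[R]_n) :
  sparse k z -> best_sparse_error k N x <= N (x - z).
Proof.
move=> hz; apply: ge_inf; last by exists z.
by exists 0 => _ [y _ <-]; apply: is_norm_ge0.
Qed.

Lemma sparse_mulrn {R : realType} {n k : nat} (x : 'rV[R]_n) (m : nat) :
  sparse k x -> sparse k (x *+ m).
Proof.
apply: leq_trans; apply/subset_leq_card/fintype.subsetP => i.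
by rewrite !inE; apply: contraNneq => xi; rewrite mulmxnE xi mul0rn.
Qed.

(** * Words encoded in base [D] and their decoding *)

Definition levels {n : nat} {T : Type} (z : T -> 'rV[int]_n) (D : nat)
    (w : nat -> T) (lo hi : nat) : 'rV[int]_n :=
  \sum_(lo <= i < hi) z (w i) *+ D ^ i.

Lemma levels_entry {n : nat} {T : Type} (z : T -> 'rV[int]_n) (D : nat)
    (w : nat -> T) (lo hi : nat) (i : 'I_n) :
  levels z D w lo hi 0 i = \sum_(lo <= l < hi) z (w l) 0 i *+ D ^ l.
Proof. by rewrite summxE; apply: eq_bigr => l _; rewrite mulmxnE. Qed.

(* The lower levels are replaced by multiples of the top point, so the
   approximant is sparse even when the points of the code are far from 0. *)
Lemma levels_near_top {R : realType} {n : nat} {N : 'rV[R]_n -> R}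
  (hN : is_norm N) {T : Type} {z : T -> 'rV[int]_n} (D : nat) {rho : R}
  (hrho : forall p q, N (map_mx intr (z p) - map_mx intr (z q)) <= rho)
  (w : nat -> T) (j : nat) :
  N (map_mx intr (levels z D w 0 j.+1)
     - map_mx intr (z (w j)) *+ \sum_(0 <= i < j.+1) D ^ i)
  <= (\sum_(0 <= i < j) D ^ i)%N%:R * rho.
Proof.
rewrite /levels raddf_sum -sumrMnr -sumrB big_nat_recr //=.
rewrite raddfMn subrr addr0 natr_sum mulr_suml.
apply: le_trans (is_norm_sum hN _ _) _; apply: ler_sum => i _.
by rewrite raddfMn -mulrnBl (is_norm_mulrn hN) ler_wpM2l ?hrho.
Qed.

(** Erasing the common levels above [j] from equal memories gives a single output. It lies within
    [(K + 1) * W * rho] of the [V]-fold multiples of both [z (w j)] and [z (w' j)], which are too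
    far apart for this if [w j] and [w' j] differ. *)
Lemma same_memory_same_level {R : realType} {n k s L D B : nat} {K rho delta : R}
  {N : 'rV[R]_n -> R} {alg : streaming_algorithm R n s}
  {T : eqType} {z : T -> 'rV[int]_n}
  (hN : is_norm N) (K0 : 0 <= K) (delta0 : 0 < delta)
  (hsolve : solves_sparse_recovery alg N k K B)
  (z_ge0 : forall p i, 0 <= z p 0 i)
  (z_sparse : forall p, sparse k (map_mx intr (z p) : 'rV[R]_n))
  (hrho : forall p q, N (map_mx intr (z p) - map_mx intr (z q)) <= rho)
  (hdelta : forall p q, p != q ->
     delta <= N (map_mx intr (z p) - map_mx intr (z q)))
  (hD : 2 * (K + 1) * rho <= D%:R * delta)
  (hB : forall w i, levels z D w 0 L 0 i <= B%:Z)
  (w w' : nat -> T) (j : nat) (jL : (j < L)%N) :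
  foldl (update alg) (initial alg) (load (levels z D w 0 L)) =
  foldl (update alg) (initial alg) (load (levels z D w' 0 L)) ->
  (forall i, (j < i < L)%N -> w i = w' i) ->
  w j = w' j.
Proof.
move=> mem_eq agree; apply/eqP; apply: contraTT isT => wj.
pose Y := levels z D w j.+1 L.
have Y' : levels z D w' j.+1 L = Y.
  by apply: eq_big_nat => i hi; rewrite agree.
have split_at v : levels z D v 0 L = levels z D v 0 j.+1 + levels z D v j.+1 L.
  by rewrite /levels -big_cat_nat.
have lev_ge0 v lo hi i : 0 <= levels z D v lo hi 0 i.
  by rewrite levels_entry; apply: sumr_ge0 => l _; rewrite mulrn_wge0.
pose V := (\sum_(0 <= i < j.+1) D ^ i)%N; pose W := (\sum_(0 <= i < j) D ^ i)%N.
(* This identity drives the contradiction: by [hD], the separation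
   [V * delta = delta + W * D * delta] strictly exceeds the two decoding errors
   [2 * (K + 1) * W * rho]. *)
have VW : V = (1 + D * W)%N.
  rewrite /V /W big_nat_recl // expn0 big_distrr /=; congr (_ + _)%N.
  by apply: eq_bigr => i _; rewrite expnS.
(* For a word whose levels above [j] sum to [Y], the first half is the load of its full encoding, so
   the memory is then the one assumed equal. *)
pose us v := load (levels z D v 0 j.+1 + Y) ++ load (- Y).
have decode v : levels z D v j.+1 L = Y ->
    N (map_mx intr (z (v j)) *+ V - run alg (us v)) <= (K + 1) * (W%:R * rho).
  move=> hv; have near := levels_near_top hN D hrho v j.
  have prom : promise B (us v).
    apply: promise_load_sub => i; try exact: lev_ge0.
    by have := hB v i; rewrite split_at hv mxE.
  have := hsolve _ prom.
  rewrite stream_vector_cat !stream_vector_load addrK /= => hrun.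
  apply: le_trans (is_norm_dist_triangle hN (map_mx intr (levels z D v 0 j.+1)) _ _) _.
  rewrite (is_norm_sym hN) mulrDl mul1r addrC; apply: lerD (near).
  apply: le_trans hrun _; rewrite ler_wpM2l //.
  by apply: le_trans (best_sparse_error_le hN _ _ _) near; exact: sparse_mulrn.
have run_eq : run alg (us w) = run alg (us w').
  by rewrite /run /us !foldl_cat -{1}/Y -split_at mem_eq split_at Y'.
have dw := decode w erefl; have := decode w' Y'; rewrite -run_eq => dw'.
have := is_norm_dist_triangle hN (run alg (us w))
  (map_mx intr (z (w j)) *+ V) (map_mx intr (z (w' j)) *+ V).
rewrite (is_norm_sym hN (run alg (us w))) -mulrnBl (is_norm_mulrn hN) => tri.
have sep : V%:R * delta <= V%:R * N (map_mx intr (z (w j)) - map_mx intr (z (w' j))).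
  by rewrite ler_wpM2l ?hdelta.
have : W%:R * (2 * (K + 1) * rho) <= W%:R * (D%:R * delta) by rewrite ler_wpM2l.
move: sep tri dw dw'; rewrite VW natrD natrM !mulrDl !mul1r; lra.
Qed.

(** Words are decoded from the top level down; the induction variable [t] bounds the number of
    levels from [j] upwards. *)
Lemma same_memory_same_word {R : realType} {n k s L D B : nat} {K rho delta : R}
  {N : 'rV[R]_n -> R} {alg : streaming_algorithm R n s}
  {T : eqType} {z : T -> 'rV[int]_n}
  (hN : is_norm N) (K0 : 0 <= K) (delta0 : 0 < delta)
  (hsolve : solves_sparse_recovery alg N k K B)
  (z_ge0 : forall p i, 0 <= z p 0 i)
  (z_sparse : forall p, sparse k (map_mx intr (z p) : 'rV[R]_n))
  (hrho : forall p q, N (map_mx intr (z p) - map_mx intr (z q)) <= rho)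
  (hdelta : forall p q, p != q ->
     delta <= N (map_mx intr (z p) - map_mx intr (z q)))
  (hD : 2 * (K + 1) * rho <= D%:R * delta)
  (hB : forall w i, levels z D w 0 L 0 i <= B%:Z)
  (w w' : nat -> T) :
  foldl (update alg) (initial alg) (load (levels z D w 0 L)) =
  foldl (update alg) (initial alg) (load (levels z D w' 0 L)) ->
  forall j, (j < L)%N -> w j = w' j.
Proof.
move=> mem_eq.
suff agree t j : (j < L)%N -> (L <= j + t)%N -> w j = w' j.
  by move=> j jL; apply: (agree L) => //; apply: leq_addl.
elim: t j => [|t IH] j jL jt; first lia.
apply: (same_memory_same_level hN K0 delta0 hsolve) mem_eq _ => // i ji.
apply: IH; lia.
Qed.

Lemma code_size_le_memory {R : realType} {n k s L D B M : nat} {K rho delta : R}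
  {N : 'rV[R]_n -> R} {alg : streaming_algorithm R n s}
  {z : 'I_M.+1 -> 'rV[int]_n}
  (hN : is_norm N) (K0 : 0 <= K) (delta0 : 0 < delta)
  (hsolve : solves_sparse_recovery alg N k K B)
  (z_ge0 : forall p i, 0 <= z p 0 i)
  (z_sparse : forall p, sparse k (map_mx intr (z p) : 'rV[R]_n))
  (hrho : forall p q, N (map_mx intr (z p) - map_mx intr (z q)) <= rho)
  (hdelta : forall p q, p != q ->
     delta <= N (map_mx intr (z p) - map_mx intr (z q)))
  (hD : 2 * (K + 1) * rho <= D%:R * delta)
  (hB : forall w i, levels z D w 0 L 0 i <= B%:Z) :
  (M.+1 ^ L <= 2 ^ s)%N.
Proof.
pose mem (t : L.-tuple 'I_M.+1) :=
  foldl (update alg) (initial alg) (load (levels z D (nth ord0 t) 0 L)).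
have inj_mem : injective mem.
  move=> t t' /(same_memory_same_word hN K0 delta0 hsolve z_ge0 z_sparse hrho
    hdelta hD hB) tt'.
  apply/val_inj/(@eq_from_nth _ ord0); rewrite ?size_tuple // => i; exact: tt'.
by have := leq_card mem inj_mem; rewrite !card_tuple card_ord card_bool.
Qed.

(** * Separated sparse points and their rounding to integers *)

Lemma separated_family {R : realType} {T : Type} {S : set T} {dist : T -> T -> R}
  {d : nat} :
  (forall x y, dist x y = dist y x) -> ~ half_covered S dist d ->
  exists c r (g : 'I_(2 ^ d).+1 -> T),
    [/\ 0 < r, forall p, S (g p) /\ dist c (g p) <= r
      & forall p q, p != q -> r / 2 < dist (g p) (g q)].
Proof.
move=> sym nh.
have [c [r [Sc r0 far]]] : exists c r, [/\ S c, 0 < r & forall f : 'I_(2 ^ d) -> T,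
    (forall i, S (f i)) ->
    exists x, [/\ S x, dist c x <= r & forall i, r / 2 < dist (f i) x]].
  apply: contrapT => no; apply: nh => c r Sc r0; apply: contrapT => nf.
  apply: no; exists c, r; split=> // f Sf; apply: contrapT => nx.
  apply: nf; exists f; split=> // x Sx cx; apply: contrapT => ni.
  apply: nx; exists x; split=> // i; rewrite ltNge; apply/negP => h.
  by apply: ni; exists i.
(* The points are chosen greedily. Since [g] is total on [nat], its first [2 ^ d] values are always
   legitimate centers, even those past [m], which are mere padding; the new point is far from all of
   them. *)
have greedy m : (m <= (2 ^ d).+1)%N -> exists g : nat -> T,
    [/\ forall i, S (g i), forall i, (i < m)%N -> dist c (g i) <= r
      & forall i j, (i < j < m)%N -> r / 2 < dist (g i) (g j)].
  elim: m => [|m IH] hm.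
    by exists (fun=> c); split=> // i j; rewrite andbF.
  have [g [Sg gr gsep]] := IH (ltnW hm).
  have [x [Sx cx xsep]] := far (fun i => g i) (fun i => Sg i).
  exists (fun i => if (i < m)%N then g i else x); split=> [i|i im|i j /andP[ij jm]].
  - by case: ifP.
  - by case: ifP => // /gr.
  - have im : (i < m)%N by lia.
    rewrite im; case: ifP => jm'; first by apply: gsep; rewrite ij.
    have id : (i < 2 ^ d)%N by lia.
    exact: (xsep (Ordinal id)).
have [g [Sg gr gsep]] := greedy _ (leqnn _).
exists c, r, (fun p => g p); split=> // [p|p q].
  by split; [exact: Sg | exact: gr].
rewrite -val_eqE /= neq_ltn => /orP[] pq; last rewrite sym.
  by apply: gsep; rewrite pq /=.
by apply: gsep; rewrite pq /=.
Qed.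

(** Scaling by [t] turns [r] into [16 * e], so distances lie between [8 * e] and [32 * e]; rounding
    both points changes them by at most [2 * e]. *)
Lemma integer_code {R : realType} {n k : nat} {N : 'rV[R]_n -> R} {C r : R}
  {T : eqType} {c : 'rV[R]_n} {g : T -> 'rV[R]_n}
  (hN : is_norm N) (C0 : 0 < C) (n0 : (0 < n)%N) (r0 : 0 < r)
  (hlo : forall x, x != 0 -> C^-1 <= N x / l2norm x)
  (hup : forall x, x != 0 -> N x / l2norm x <= C)
  (hg : forall p, nonneg_sparse k (g p) /\ N (c - g p) <= r)
  (gsep : forall p q, p != q -> r / 2 < N (g p - g q)) :
  exists z : T -> 'rV[int]_n,
    [/\ forall p i, 0 <= z p 0 i <= Num.floor (32 * C * (C * n%:R)),
        forall p, sparse k (map_mx intr (z p) : 'rV[R]_n),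
        forall p q, N (map_mx intr (z p) - map_mx intr (z q))
          <= 34 * (C * n%:R)
      & forall p q, p != q ->
          6 * (C * n%:R) <= N (map_mx intr (z p) - map_mx intr (z q))].
Proof.
have [_ NZ _] := hN.
set e := C * n%:R; have e0 : 0 < e by rewrite mulr_gt0 ?ltr0n.
pose t := 16 * e / r; have t0 : 0 < t by rewrite divr_gt0 // mulr_gt0 ?ltr0n.
have tr : t * r = 16 * e by rewrite /t divfK ?gt_eqF.
(* On the coordinates where [c] exceeds [C * r] every [g p] is positive, so
   they can be lowered without leaving the nonnegative sparse vectors. *)
pose v : 'rV[R]_n := \row_i Num.max 0 (c 0 i - C * r).
pose h p : 'rV[R]_n := t *: (g p - v).
have near_c p i : `|c 0 i - g p 0 i| <= C * r.
  have [_ gr] := hg p; have := entry_le_norm hN C0 hlo (c - g p) i.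
  by rewrite !mxE => /le_trans; apply; rewrite ler_pM2l.
have h_itv p i : 0 <= h p 0 i <= 32 * C * e.
  have [[_ /(_ i) g0] _] := hg p; have := near_c p i; rewrite ler_norml => nc.
  have -> : 32 * C * e = t * (2 * (C * r)).
    by rewrite (_ : t * _ = 2 * C * (t * r)); [rewrite tr; ring | ring].
  (* If [c 0 i > C * r], the entry lies within [C * r] of [c 0 i] and is lowered by [c 0 i - C * r].
     Otherwise it is not lowered, and it is between 0 and [c 0 i + C * r]. *)
  have /andP[lo hi] : 0 <= g p 0 i - Num.max 0 (c 0 i - C * r) <= 2 * (C * r).
    by move: nc; case: (ltrP 0 (c 0 i - C * r)); lra.
  by rewrite !mxE ler_pM2l // hi andbT; apply: mulr_ge0 lo; exact: ltW.
have h0 p i : g p 0 i = 0 -> h p 0 i = 0.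
  move=> g0; have := near_c p i; rewrite ler_norml => nc.
  rewrite !mxE g0; case: (ltrP 0 (c 0 i - C * r)) => [cr|_]; last by rewrite subrr mulr0.
  by exfalso; move: nc; rewrite g0; lra.
pose z p : 'rV[int]_n := \row_i Num.floor (h p 0 i).
have round p : N (map_mx intr (z p) - h p) <= e.
  apply: (norm_le_dim hN C0 hup) => i.
  have -> : (map_mx intr (z p) - h p) 0 i = (Num.floor (h p 0 i))%:~R - h p 0 i.
    by rewrite !mxE.
  by have := floor_itv (h p 0 i); rewrite rmorphD /= ler_norml; lra.
have hdist p q : N (h p - h q) = t * N (g p - g q).
  by rewrite -scalerBr NZ gtr0_norm // opprB subrKA.
have tri := is_norm_dist_triangle hN.
have sym := is_norm_sym hN.
exists z; split=> [p i|p|p q|p q pq].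
- have /andP[h1 h2] := h_itv p i.
  by rewrite mxE floor_ge0 h1 /= le_floor.
- have [[sp _] _] := hg p; apply: leq_trans sp.
  apply/subset_leq_card/fintype.subsetP => i; rewrite !inE.
  apply: contraNneq => /h0 hi; apply/eqP.
  by transitivity ((Num.floor (h p 0 i))%:~R : R); [rewrite !mxE | rewrite hi floor0].
- have := tri (h p) (map_mx intr (z p)) (map_mx intr (z q)).
  have := tri (h q) (h p) (map_mx intr (z q)).
  have := round p; have := round q; rewrite (sym (map_mx intr (z q)) (h q)) hdist.
  have [_ gp] := hg p; have [_ gq] := hg q.
  have gpq : t * N (g p - g q) <= t * (r + r).
    rewrite ler_pM2l // (le_trans (tri c _ _)) // lerD //.
    by rewrite sym.
  move: gpq; rewrite mulrDr tr; lra.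
- have := tri (map_mx intr (z p)) (h p) (h q).
  have := tri (map_mx intr (z q)) (map_mx intr (z p)) (h q).
  have := round p; have := round q; rewrite (sym (map_mx intr (z p)) (h p)) hdist.
  have : t * (r / 2) <= t * N (g p - g q) by rewrite ler_pM2l // ltW // gsep.
  rewrite mulrA tr; lra.
Qed.

(** * Choice of parameters and the final count *)

Lemma geometric_sum_le {D : nat} (m : nat) :
  (1 < D)%N -> (\sum_(0 <= i < m.+1) D ^ i <= 2 * D ^ m)%N.
Proof.
move=> D1; elim: m => [|m IH]; first by rewrite big_nat1.
rewrite big_nat_recr //= mul2n -addnn leq_add2r (leq_trans IH) //.
by rewrite expnS leq_mul2r D1 orbT.
Qed.

Lemma levels_entry_le {n : nat} {T : Type} {z : T -> 'rV[int]_n} {E D L B : nat} :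
  (forall p i, z p 0 i <= E%:Z) -> (E * \sum_(0 <= l < L) D ^ l <= B)%N ->
  forall w i, levels z D w 0 L 0 i <= B%:Z.
Proof.
move=> hz hB w i; rewrite levels_entry.
apply: (@le_trans _ _ (E * \sum_(0 <= l < L) D ^ l)%N%:Z); last by rewrite lez_nat.
rewrite -[X in _ <= X]natz natrM natr_sum mulr_sumr.
by apply: ler_sum => l _; rewrite mulr_natr lerMn2r natz hz orbT.
Qed.

Lemma code_word_length {R : realType} {n : nat} {K : R} :
  (0 < n)%N -> 2 < K ->
  ln n%:R <= (trunc_log (Num.truncn (20 * K)).+1 n).+1%:R * (6 * ln K).
Proof.
move=> n0 K2; set D := (Num.truncn _).+1; have K0 : 0 < K by lra.
have D1 : (1 < D)%N by rewrite ltnS truncn_gt0; lra.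
(* [D] is at most [20 * K + 1], hence below [21 * K], and [K ^+ 5] exceeds 32 because [K > 2]. *)
have DK : D%:R <= K ^+ 6.
  have : (Num.truncn (20 * K))%:R <= 20 * K by rewrite truncn_le; lra.
  have : 21 <= K ^+ 5.
    apply: (@le_trans _ _ (2 ^+ 5)); first lra.
    by rewrite lerXn2r ?nnegrE ?ltW.
  by rewrite /D -natr1 [K ^+ 6]exprS; nra.
have : ln (D%:R : R) <= 6 * ln K.
  rewrite mulr_natl -lnXn // ler_ln ?posrE ?exprn_gt0 // ltr0n; lia.
have : ln (n%:R : R) <= ln ((D%:R : R) ^+ (trunc_log D n).+1).
  rewrite ler_ln ?posrE ?exprn_gt0 ?ltr0n // -natrX ler_nat ltnW //.
  exact: trunc_log_ltn.
rewrite lnXn ?ltr0n // -[ln _ *+ _]mulr_natl => h1 h2.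
by apply: le_trans h1 _; rewrite ler_wpM2l.
Qed.

Lemma leq_double_uphalf (m : nat) : (m <= 2 * uphalf m)%N.
Proof. lia. Qed.

(** Halving the exponent, rounded up, costs a factor 2 but keeps the bound nontrivial at dimension
    1, where the code has just two points. *)
Lemma expn_uphalf_le (m : nat) : (2 ^ uphalf m.+1 <= (2 ^ m).+1)%N.
Proof. by case: m => [//|m]; rewrite leqW // leq_exp2l //; lia. Qed.

(* a bounds the exponent in the hypothesis on the norm, n ^ b is the promised
   bound on the entries; the constant c of the Omega is uniform in the rest. *)
Theorem mainTheorem2 (R : realType) (a : nat) :
  exists (b0 : nat) (c : R), 0 < c /\
  forall b : nat, (b0 <= b)%N ->
  forall (n k s d : nat) (K : R) (N : 'rV[R]_n -> R)
         (alg : streaming_algorithm R n s),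
    is_norm N ->
    (forall x : 'rV[R]_n, x != 0 ->
       n%:R ^- a <= N x / l2norm x <= n%:R ^+ a) ->
    2 < K ->
    solves_sparse_recovery alg N k K (n ^ b) ->
    doubling_dimension (@nonneg_sparse R n k) (fun x y => N (x - y)) d ->
    c * (d%:R * (ln n%:R / ln K)) <= s%:R.
Proof.
(* Entries are at most [64 * n ^ (2 * a + 2)], and [64 <= n ^ 6] once [n >= 2]. The 12 is 6, from
   [D <= K ^ 6], times 2, from halving the dimension. *)
exists (2 * a + 8)%N, (12^-1 : R); split; first by rewrite invr_gt0.
move=> b hb n k s d K N alg hN hdist K2 hsolve [_ dmin].
have K0 : 0 < K by lra.
have lnK0 : 0 < ln K by apply: ln_gt0; lra.
(* For [n <= 1] the bound is trivial; [n = 0] relies on the convention that [ln 0 = 0]. *)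
have [n1|n1] := leqP n 1.
  have -> : ln (n%:R : R) = 0 by move: n1; case: n {N alg hN hdist hsolve dmin}
    => [|[|//]] _; [exact: ln0 | exact: ln1].
  by rewrite mul0r !mulr0.
have n0 : (0 < n)%N by lia.
case: d dmin => [|d] dmin; first by rewrite mul0r mulr0.
have not_covered : ~ half_covered (@nonneg_sparse R n k)
    (fun x y => N (x - y)) d by move/dmin; rewrite ltnn.
have [c [r [g [r0 hg gsep]]]] :=
  separated_family (is_norm_sym hN) not_covered.
pose C : R := n%:R ^+ a; have C0 : 0 < C by rewrite exprn_gt0 ?ltr0n.
have hlo x : x != 0 -> C^-1 <= N x / l2norm x by move/hdist/andP=> [].
have hup x : x != 0 -> N x / l2norm x <= C by move/hdist/andP=> [].
have [z [z_itv z_sparse z_near z_far]] :=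
  integer_code hN C0 n0 r0 hlo hup hg gsep.
(* [D ^ (L - 1) <= n < D ^ L]: the first inequality keeps the encoding polynomially bounded, the
   second makes the words long enough. *)
pose D := (Num.truncn (20 * K)).+1; pose L := (trunc_log D n).+1.
have DK : 20 * K < D%:R by exact: truncnS_gt.
have D1 : (1 < D)%N by rewrite ltnS truncn_gt0; lra.
have e0 : 0 < C * n%:R by rewrite mulr_gt0 ?ltr0n.
have z_ge0 p i : 0 <= z p 0 i by case/andP: (z_itv p i).
have z_le p i : z p 0 i <= (32 * n ^ a * (n ^ a * n))%N%:Z.
  have /andP[_] := z_itv p i; move/le_trans; apply.
  by rewrite -ltzD1 floor_lt_int rmorphD /= -pmulrn !natrM !natrX ltrDl.
have total : (32 * n ^ a * (n ^ a * n) * \sum_(0 <= l < L) D ^ l <= n ^ b)%N.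
  apply: leq_trans (leq_pexp2l n0 hb).
  have sumD : (\sum_(0 <= l < L) D ^ l <= 2 * n)%N.
    by rewrite (leq_trans (geometric_sum_le _ D1)) // leq_mul2l trunc_logP.
  have n6 : (64 <= n ^ 6)%N by rewrite -[64%N]/(2 ^ 6)%N leq_exp2r.
  apply: leq_trans (leq_mul (leqnn _) sumD) _.
  rewrite (_ : 2 * a + 8 = a + a + 2 + 6)%N; last by lia.
  rewrite !expnD [X in (_ <= X)%N]mulnC.
  apply: leq_trans (leq_mul n6 (leqnn _)); rewrite -mulnn; lia.
(* After cancelling [C * n], this is [68 * (K + 1) <= 6 * D], which follows from [D > 20 * K] and
   [K > 2]. *)
have hD : 2 * (K + 1) * (34 * (C * n%:R)) <= D%:R * (6 * (C * n%:R)).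
  rewrite !mulrA -!(mulrA _ C) ler_pM2r //; lra.
have e6 : 0 < 6 * (C * n%:R) by lra.
have := code_size_le_memory hN (ltW K0) e6 hsolve z_ge0 z_sparse z_near
  z_far hD (levels_entry_le z_le total).
move=> /(leq_trans (_ : (2 ^ uphalf d.+1) ^ L <= _)%N).
rewrite leq_exp2r // expn_uphalf_le -expnM leq_exp2l // => /(_ isT) hs.
have hL : ln n%:R <= L%:R * (6 * ln K) := code_word_length n0 K2.
have dL : d.+1%:R * L%:R <= 2 * s%:R :> R.
  rewrite -!natrM ler_nat (leq_trans _ (leq_mul (leqnn 2) hs)) // mulnA.
  by rewrite leq_mul2r leq_double_uphalf orbT.
rewrite mulrA mulrA ler_pdivrMr //.
have : d.+1%:R * ln n%:R <= d.+1%:R * (L%:R * (6 * ln K)) by rewrite ler_wpM2l.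
have : d.+1%:R * L%:R * (6 * ln K) <= 2 * s%:R * (6 * ln K).
  by rewrite ler_wpM2r //; lra.
lra.
Qed.
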